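(* Let $(x_n)$ be a normalized, bimonotone, weakly null sequence in a real Banach space and $\xi<\omega_1$. Assume $(x_n)$ is an $\ell_1^{\xi}$ spreading model. Then there exists $M=(m_i)\in[\mathbb N]$ such that $(x_{m_i})$ is $S_\xi$ unconditional.
   Context: Bimonotone: for all finitely supported scalars $(a_i)$ and all $n$, $\max\{\|\sum_{i\le n}a_ix_i\|,\|\sum_{i>n}a_ix_i\|\}\le\|\sum_ia_ix_i\|$. For each countable ordinal $\xi$ fix successor ordinals $(\beta_n(\xi)+1)_n$: equal to $\xi$ if $\xi$ is a successor, strictly increasing to $\xi$ if $\xi$ is a limit. Schreier families: $S_0=\{\{n\}:n\in\mathbb N\}\cup\{\emptyset\}$; $S_{\zeta+1}=\{\bigcup_{i=1}^nF_i:n\le\min F_1,\ F_1<\cdots<F_n,\ F_i\in S_\zeta\}\cup\{\emptyset\}$ ($F<G$ means $\max F<\min G$); for limit $\xi$, $S_\xi=\{F:F\in S_{\beta_n(\xi)+1}\text{ for some }n\le\min F\}$. A semi-normalized $(y_i)$ is an $\ell_1^\xi$ spreading model if for some $c>0$, $\|\sum_{i\in F}a_iy_i\|\ge c\sum_{i\in F}|a_i|$ for all $F\in S_\xi$ and scalars. $(y_i)$ is $S_\xi$ unconditional if there is $C>0$ with $\|\sum_{i\in F}a_iy_i\|\le C\|\sum_{i=1}^\infty a_iy_i\|$ for every $F\in S_\xi$ and every finitely supported scalar sequence $(a_i)$. *)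

(* Defs.v *)
From HB Require Import structures.
From mathcomp Require Import all_boot all_order all_algebra.
From mathcomp Require Import all_classical all_reals all_analysis.
Set Implicit Arguments. Unset Strict Implicit. Unset Printing Implicit Defensive.
Import Order.TTheory GRing.Theory Num.Theory.
Import numFieldNormedType.Exports.
Local Open Scope classical_set_scope.
Local Open Scope ring_scope.

(* Countable ordinals as Brouwer trees: zero, successor, limit of a sequence. *)
Inductive cord : Type :=
| OZ : cord
| OS : cord -> cord
| OL : (nat -> cord) -> cord.

Inductive ole : cord -> cord -> Prop :=
| ole_Z y : ole OZ y
| ole_SS x y : ole x y -> ole (OS x) (OS y)
| ole_Sr x y : ole x y -> ole x (OS y)
| ole_Ll f y : (forall n, ole (f n) y) -> ole (OL f) y
| ole_Lr x f n : ole x (f n) -> ole x (OL f).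

Definition olt (x y : cord) : Prop := ole (OS x) y.

Inductive subtree : cord -> cord -> Prop :=
| sub_refl a : subtree a a
| sub_S a b : subtree a b -> subtree a (OS b)
| sub_L a f n : subtree a (f n) -> subtree a (OL f).

Inductive wf_cord : cord -> Prop :=
| wf_Z : wf_cord OZ
| wf_S a : wf_cord a -> wf_cord (OS a)
| wf_L (b : nat -> cord) :
    (forall n, wf_cord (b n)) ->
    (forall n, olt (OS (b n)) (OS (b n.+1))) ->
    wf_cord (OL (fun n => OS (b n))).

(* The fundamental sequences used inside xi are chosen consistently: two
   subtrees of xi denoting the same ordinal are identical.  Together with
   wf_cord this says xi (with its fundamental sequences) comes from one fixed
   global choice of sequences (beta_n(zeta)+1)_n, as in the paper. *)
Definition consistent_cord (xi : cord) : Prop :=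
  forall a b, subtree a xi -> subtree b xi -> ole a b -> ole b a -> a = b.

Definition ctbl_ordinal (xi : cord) : Prop := wf_cord xi /\ consistent_cord xi.

(* Finite subsets of N = {1,2,...} are represented as strictly increasing
   sequences of positive naturals. *)
Fixpoint schreier (xi : cord) (F : seq nat) : Prop :=
  match xi with
  | OZ => F = [::] \/ exists n, (1 <= n)%N /\ F = [:: n]
  | OS z => F = [::] \/
      exists Fs : seq (seq nat),
        [/\ F = flatten Fs, sorted ltn (flatten Fs),
            Fs != [::] /\ all (fun G => G != [::]) Fs,
            (forall G, G \in Fs -> schreier z G) &
            (size Fs <= head 0%N (head [::] Fs))%N]
  | OL f => F = [::] \/
      (* f n is beta_{n+1}(xi)+1; the condition is n+1 <= min F *)
      exists n, (n.+1 <= head 0%N F)%N /\ schreier (f n) F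
  end.

Section Seqs.
Variables (R : realType) (V : normedModType R).

(* Sequences x : nat -> V are indexed by N = {1,2,...}; x 0 is ignored. *)
Definition normalized (x : nat -> V) : Prop := forall i, (1 <= i)%N -> `|x i| = 1.

Definition bimonotone (x : nat -> V) : Prop :=
  forall (a : nat -> R) (N : nat), (forall i, (N <= i)%N -> a i = 0) ->
  forall n : nat,
    `|\sum_(1 <= i < n.+1) a i *: x i| <= `|\sum_(1 <= i < N) a i *: x i| /\
    `|\sum_(n.+1 <= i < N) a i *: x i| <= `|\sum_(1 <= i < N) a i *: x i|.

Definition weakly_null (x : nat -> V) : Prop :=
  forall f : V -> R,
    (forall (c : R) (u v : V), f (c *: u + v) = c * f u + f v) ->
    continuous f ->
    (fun n => f (x n)) @ \oo --> (0 : R).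

Definition ell1_spreading_model (xi : cord) (y : nat -> V) : Prop :=
  (exists2 K : R, 0 < K & forall i, (1 <= i)%N -> K^-1 <= `|y i| <= K) /\
  exists2 c : R, 0 < c &
    forall F, schreier xi F -> forall a : nat -> R,
      c * \sum_(i <- F) `|a i| <= `|\sum_(i <- F) a i *: y i|.

Definition schreier_unconditional (xi : cord) (y : nat -> V) : Prop :=
  exists2 C : R, 0 < C &
    forall F, schreier xi F ->
    forall (a : nat -> R) (N : nat), (forall i, (N <= i)%N -> a i = 0) ->
      `|\sum_(i <- F) a i *: y i| <= C * `|\sum_(1 <= i < N) a i *: y i|.

End Seqs.

(* Main.v *)
Require Import Defs.
From HB Require Import structures.
From mathcomp Require Import all_boot all_order all_algebra.
From mathcomp Require Import all_classical all_reals all_analysis.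
From mathcomp Require Import lra.
Import Order.TTheory GRing.Theory Num.Theory.
Import numFieldNormedType.Exports.
Local Open Scope ring_scope.

(** After passing to a subsequence, every functional of norm at most one which is at least c
on the terms x_i, i in F, of a finite set F can be replaced by one which is still
at least c on these terms and is at most 2^-(i+1) in absolute value on the other
terms (a lemma of Argyros, Mercourakis and Tsarpalias). The points of the
subsequence are chosen one by one: a new point is acceptable when the functionals
following any prescribed big/small pattern at the earlier points can be made small
at it whatever the later points where they have to be big. That almost all points
are acceptable follows from weak nullity, by a Nash-Williams type argument in
which the Ramsey theorem is replaced by quantification along a free ultrafilter.

Given F in S_xi and scalars a, Hahn-Banach turns the lower l1-estimate into a
functional in the dual ball which is at least c on the part of F where a is positive.
Its replacement, applied to the sum of the a_i x_(m_i), together with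
|a_i| <= ||sum a|| (bimonotonicity), bounds the sum of the positive a_i over F by
(2/c) ||sum a||. The negative part is treated in the same way. *)

(** * Sublinear functionals and the Hahn-Banach theorem *)

Definition sublinear {R : realType} {V : lmodType R} (q : V -> R) : Prop :=
  (forall u v, q (u + v) <= q u + q v) /\
  (forall t u, 0 < t -> q (t *: u) = t * q u).

Definition linear_form {R : realType} {V : lmodType R} (f : V -> R) : Prop :=
  forall (c : R) (u v : V), f (c *: u + v) = c * f u + f v.

Section HahnBanach.
Local Open Scope classical_set_scope.
Context {R : realType} {V : lmodType R}.

Lemma sublinear0 (q : V -> R) : sublinear q -> q 0 = 0.
Proof.
move=> [_ qZ]; have := qZ 2 0 ltac:(lra); rewrite scaler0; lra.
Qed.

Lemma sublinear_oppr_ge (q : V -> R) v : sublinear q -> - q (- v) <= q v.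
Proof.
move=> sq; have := sq.1 v (- v); rewrite subrr (sublinear0 _ sq); lra.
Qed.

(** The bound [b] keeps the infima finite. The last two hypotheses are subadditivity and homogeneity
    up to a change of index, which the infimum absorbs. *)
Lemma inf_sublinear {I : Type} (A : set I) (F : I -> V -> R) (b : V -> R) :
  A !=set0 ->
  (forall i v, A i -> b v <= F i v) ->
  (forall i j u v, A i -> A j ->
    exists2 k, A k & F k (u + v) <= F i u + F j v) ->
  (forall i t v, A i -> 0 < t -> exists2 j, A j & F j (t *: v) <= t * F i v) ->
  let p := fun v => inf [set F i v | i in A] in
  sublinear p /\ (forall i v, A i -> p v <= F i v).
Proof.
move=> [i0 Ai0] bF FD FZ p.
have p_le i v : A i -> p v <= F i v.
  move=> Ai; apply: ge_inf; last by exists i.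
  by exists (b v) => _ [j Aj <-]; exact: bF.
have le_p c v : (forall i, A i -> c <= F i v) -> c <= p v.
  move=> cF; apply: lb_le_inf; first by exists (F i0 v), i0.
  by move=> _ [i Ai <-]; exact: cF.
have pZ t v : 0 < t -> p (t *: v) <= t * p v.
  move=> t0; rewrite -ler_pdivrMl//; apply: le_p => i Ai.
  have [j Aj jle] := FZ i t v Ai t0.
  by rewrite ler_pdivrMl// (le_trans (p_le _ _ Aj)).
split=> //; split=> [u v|t v t0].
  rewrite -lerBlDr; apply: (le_p) => i Ai; rewrite lerBlDr -lerBlDl.
  apply: le_p => j Aj; rewrite lerBlDl.
  have [k Ak kle] := FD i j u v Ai Aj.
  exact: le_trans (p_le _ _ Ak) kle.
(* The reverse inequality is [pZ] applied to [t^-1] and [t *: v]. *)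
apply/eqP; rewrite eq_le pZ//= -ler_pdivlMl//.
rewrite -[X in p X <= _]scale1r -(mulVf (lt0r_neq0 t0)) -scalerA.
by apply: pZ; rewrite invr_gt0.
Qed.

(* Zorn's lemma: a chain is bounded below by its pointwise infimum. *)
Lemma minimal_sublinear (p : V -> R) : sublinear p ->
  exists q : V -> R, [/\ sublinear q, forall v, q v <= p v &
    forall q', sublinear q' -> (forall v, q' v <= q v) -> q' = q].
Proof.
move=> sp.
pose T := {q : V -> R | sublinear q /\ forall v, q v <= p v}.
pose Rl (r s : T) := `[< forall v, sval s v <= sval r v >].
have sval_inj (r s : T) : sval r = sval s -> r = s.
  case: r s => [r rP] [s sP] /= rs; subst s.
  by congr exist; exact: Prop_irrelevance.
have [||||[q [sq qp]] qmin] := @Zorn T Rl.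
- by move=> r; apply/asboolP => v.
- by move=> r s t /asboolP rs /asboolP st; apply/asboolP => v;
    exact: le_trans (st v) (rs v).
- move=> r s /asboolP rs /asboolP sr; apply: sval_inj; apply/funext => v.
  by apply/eqP; rewrite eq_le rs sr.
- move=> A totA; have [->|A0] := eqVneq A set0.
    by exists (exist _ p (conj sp (fun=> lexx _))).
  have {}A0 : A !=set0 by apply/set0P.
  (* The common lower bound works because [- p (- v) <= - r (- v) <= r v] for every [r] in the
     chain. *)
  have [||||sr rle] := @inf_sublinear _ A (fun q => sval q) (fun v => - p (- v)).
  + exact: A0.
  + move=> [r [sr rp]] v _ /=.
    by apply: le_trans (sublinear_oppr_ge _ v sr); rewrite lerN2.
  + move=> r s u v Ar As; have [/asboolP rs|/asboolP sr] := totA _ _ Ar As.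
      exists s => //; apply: le_trans ((svalP s).1.1 u v) _.
      by rewrite lerD2r.
    exists r => //; apply: le_trans ((svalP r).1.1 u v) _.
    by rewrite lerD2l.
  + by move=> r t v Ar t0; exists r => //; rewrite (svalP r).1.2.
  set r := (fun v => _) in sr rle.
  have rp v : r v <= p v.
    by case: A0 => s As; exact: le_trans (rle s v As) ((svalP s).2 v).
  exists (exist _ r (conj sr rp)) => s As; apply/asboolP => v /=; exact: rle.
exists q; split=> // q' sq' q'q.
have q'p v : q' v <= p v by exact: le_trans (q'q v) (qp v).
have := qmin (exist _ q' (conj sq' q'p)) (asboolT q'q).
by move=> /(congr1 sval).
Qed.

(* Minimality forces [q] to equal [v |-> inf_(t >= 0) (q (v + t *: y) - t * q y)],
   whence [q u + q y <= q (u + y)]. *)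
Lemma minimal_sublinear_linear (q : V -> R) : sublinear q ->
  (forall q', sublinear q' -> (forall v, q' v <= q v) -> q' = q) ->
  linear_form q.
Proof.
move=> sq qmin.
have q0 := sublinear0 _ sq.
have qZ t u : 0 <= t -> q (t *: u) = t * q u.
  by rewrite le_eqVlt => /predU1P[<-|/sq.2->//]; rewrite scale0r q0 mul0r.
have qD u y : q (u + y) = q u + q y.
  apply/eqP; rewrite eq_le sq.1/=.
  pose F (t : R) v := q (v + t *: y) - t * q y.
  have [||||sr rle] := @inf_sublinear _ [set t | 0 <= t] F (fun v => - q (- v)).
  - by exists 0 => /=.
  - move=> t v /= t0; rewrite /F -qZ//.
    have := sq.1 (- v) (v + t *: y); rewrite addKr; lra.
  - move=> s t v w /= s0 t0; exists (s + t); first exact: addr_ge0.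
    rewrite /F /=; have := sq.1 (v + s *: y) (w + t *: y).
    rewrite addrACA -scalerDl; lra.
  - move=> s t v /= s0 t0; exists (t * s); first by rewrite mulr_ge0// ltW.
    by rewrite /F -scalerA -scalerDr sq.2// mulrBr mulrA.
  suff pq v : inf [set F t v | t in [set t | 0 <= t]] <= q v.
    rewrite -(congr1 (fun g => g u) (qmin _ sr pq)).
    by have := rle 1 u ler01; rewrite /F scale1r mul1r; lra.
  by have := rle 0 v (lexx _); rewrite /F scale0r addr0 mul0r subr0.
have qN u : q (- u) = - q u by have := qD u (- u); rewrite subrr q0; lra.
move=> c u v; rewrite qD; congr (_ + _); have [c0|c0] := leP 0 c; first exact: qZ.
by have := qZ (- c) u; rewrite scaleNr qN oppr_ge0 ltW// => /(_ isT); lra.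
Qed.

Lemma hahn_banach (p : V -> R) : sublinear p ->
  exists2 f : V -> R, linear_form f & forall v, f v <= p v.
Proof.
move=> /minimal_sublinear[q [sq qp qmin]].
by exists q => //; exact: minimal_sublinear_linear.
Qed.

End HahnBanach.

(** * The dual ball: norming functionals and pointwise limits *)

Section DualBall.
Local Open Scope classical_set_scope.
Context {R : realType} {V : normedModType R}.

Definition dual_ball (f : V -> R) : Prop :=
  linear_form f /\ forall v, `|f v| <= `|v|.

Lemma linear_form_sum (f : V -> R) (I : Type) (r : seq I) (a : I -> R)
    (y : I -> V) : linear_form f ->
  f (\sum_(i <- r) a i *: y i) = \sum_(i <- r) a i * f (y i).
Proof.
move=> lf; have f0 : f 0 = 0.
  by have := lf (-1) 0 0; rewrite scaler0 addr0 mulN1r addNr.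
by elim: r => [|i r IH]; rewrite ?big_nil// !big_cons lf IH.
Qed.

Lemma dual_ball_cvg0 (x : nat -> V) (f : V -> R) :
  weakly_null x -> dual_ball f -> (fun n => f (x n)) @ \oo --> (0 : R).
Proof.
move=> wx [lf fb]; apply: wx => // v.
apply/cvgrPdist_le => e e0; near=> w.
have -> : f v - f w = f (v - w).
  by have := lf (-1) w v; rewrite scaleN1r addrC mulN1r addrC => ->; rewrite addrC.
apply: le_trans (fb _) _; near: w.
exact: cvgr_dist_le.
Unshelve. all: by end_near. Qed.

(* The dual form of the lower l1-estimate: by Hahn-Banach applied to
   [v |-> inf_(a >= 0) (`|v + \sum_i a i *: x i| - c * \sum_i a i)]. *)
Lemma norming_functional (x : nat -> V) (F : seq nat) (c : R) : uniq F ->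
  (forall a : nat -> R, (forall i, 0 <= a i) ->
     c * \sum_(i <- F) a i <= `|\sum_(i <- F) a i *: x i|) ->
  exists2 f, dual_ball f & forall i, i \in F -> c <= f (x i).
Proof.
move=> uF lF.
pose S (a : nat -> R) := \sum_(i <- F) a i.
pose X (a : nat -> R) := \sum_(i <- F) a i *: x i.
pose G a v := `|v + X a| - c * S a.
have SD a b : S (a \+ b) = S a + S b by rewrite /S -big_split.
have XD a b : X (a \+ b) = X a + X b.
  by rewrite /X -big_split; apply: eq_bigr => i _; rewrite scalerDl.
have SZ t a : S (fun i => t * a i) = t * S a by rewrite /S mulr_sumr.
have XZ t a : X (fun i => t * a i) = t *: X a.
  by rewrite /X scaler_sumr; apply: eq_bigr => i _; rewrite scalerA.
have [||||/hahn_banach[f lf fp] pG] := @inf_sublinear _ _ _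
  [set a : nat -> R | forall i, 0 <= a i] G (fun v => - `|v|).
- by exists (fun=> 0) => i.
- move=> a v a0; rewrite /G.
  have := lF a a0; rewrite -/(S a) -/(X a).
  have := ler_normD (v + X a) (- v); rewrite addrAC subrr add0r normrN; lra.
- move=> a b u v a0 b0; exists (a \+ b); first by move=> i; rewrite addr_ge0/=.
  rewrite /G SD XD; have := ler_normD (u + X a) (v + X b); rewrite addrACA; lra.
- move=> a t v a0 t0; exists (fun i => t * a i).
    by move=> i; rewrite mulr_ge0// ltW.
  by rewrite /G SZ XZ -scalerDr normrZ gtr0_norm//; lra.
have fN v : f (- v) = - f v.
  have := lf (-1) v 0; have := lf (-1) 0 0.
  by rewrite !scaleN1r oppr0 !addr0; lra.
have f_le v : f v <= `|v|.
  have := le_trans (fp v) (pG (fun=> 0) v (fun=> lexx _)).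
  rewrite /G; have -> : X (fun=> 0) = 0 by rewrite /X big1// => j _; rewrite scale0r.
  by rewrite /S big1// addr0 mulr0 subr0.
exists f.
  by split=> // v; rewrite ler_norml f_le lerNl -fN -[`|v|]normrN f_le.
move=> i iF.
(* At [- x i] the indicator of [i] cancels the vector and leaves [- c], so [f (- x i) <= - c]. *)
have := le_trans (fp (- x i)) (pG (fun j => (j == i)%:R) (- x i) (fun=> ler0n _ _)).
have -> : G (fun j => (j == i)%:R) (- x i) = - c.
  rewrite /G /S /X !(bigD1_seq i)//= eqxx !big1; last first.
  - by move=> j /negPf->; rewrite scale0r.
  - by move=> j /negPf->.
  by rewrite scale1r !addr0 addNr normr0 mulr1 sub0r.
by rewrite fN; lra.
Qed.

(** The values at [v] stay in a compact interval, so they converge along [U]; linearity and the norm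
    bound pass to the limit. *)
Lemma dual_ball_ultralimit (f : nat -> V -> R) (U : set_system nat) :
  UltraFilter U -> (forall n, dual_ball (f n)) ->
  exists2 g, dual_ball g & forall v, f ^~ v @ U --> g v.
Proof.
move=> UU fb.
have cv v : exists l : R, f ^~ v @ U --> l.
  have [|l [_ lc]] := @segment_compact R (- `|v|) `|v| (f ^~ v @ U) _.
    by apply: (@filterE _ U) => n /=; rewrite in_itv/= -ler_norml (fb n).2.
  (* A cluster point of an ultrafilter is its limit. *)
  exists l => B Bl; have [//|UnB] := in_ultra_setVsetC (f ^~ v @^-1` B) UU.
  by have [r [/= nBr Br]] := lc (~` B) B UnB Bl.
have {cv}[g fg] := choice cv; exists g => //; split.
  move=> c u v.
  have fuv : (fun n => c * f n u + f n v) @ U --> c * g u + g v.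
    by apply: cvgD; [apply: cvgM; [exact: cvg_cst|exact: fg]|exact: fg].
  have -> : g (c *: u + v) = lim (f ^~ (c *: u + v) @ U).
    by rewrite (cvg_lim _ (fg _)).
  rewrite (_ : f ^~ _ = (fun n => c * f n u + f n v)) ?(cvg_lim _ fuv)//.
  by apply/funext => n; exact: (fb n).1.
move=> v; apply: (cvgr_to_le (cvg_norm (fg v))).
by apply: filterE => n; exact: (fb n).2.
Qed.

End DualBall.

(** * Iterated quantification along an ultrafilter *)

Section Forcing.
Local Open Scope classical_set_scope.
Context {U : set_system nat}.

(* For almost all n_1, for almost all n_2, ... (in the sense of the ultrafilter
   [U]) the sequence [s] followed by n_1, n_2, ... runs into [P]. *)
Inductive forced (P : set (seq nat)) : seq nat -> Prop :=
| forced_now s of P s : forced P s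
| forced_later s A of U A & (forall n, A n -> forced P (rcons s n)) :
    forced P s.

Definition rcons_closed (P : set (seq nat)) : Prop :=
  forall s n, P s -> P (rcons s n).

Lemma forced_rcons {FU : Filter U} P s : rcons_closed P -> forced P s ->
  \forall n \near U, forced P (rcons s n).
Proof.
move=> cP [{}s Ps|{}s A UA AP]; last exact: filterS UA.
by apply: filterE => n; apply/forced_now/cP.
Qed.

(** Once [P] is reached it persists, so one continues along the derivation for [Q]; before that,
    [forced_rcons] carries the derivation for [Q] to the extended sequence. *)
Lemma forcedI {FU : Filter U} P Q s : rcons_closed P -> rcons_closed Q ->
  forced P s -> forced Q s -> forced (P `&` Q) s.
Proof.
move=> cP cQ fP; elim: fP => {s} [s Ps fQ|s A UA AP IH fQ].
  elim: fQ Ps => {s} [s Qs Ps|s A UA AQ IH Ps]; first exact: forced_now.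
  by apply: (forced_later _ _ _ UA) => n An; exact/IH/cP.
apply: (forced_later _ _ _ (filterI UA (forced_rcons _ _ cQ fQ))).
by move=> n [An Qn]; exact: IH.
Qed.

Lemma forced_ex {FU : ProperFilter U} P s : forced P s -> exists t, P t.
Proof.
elim=> {s} [s Ps|s A UA _ IH]; first by exists s.
by have [n /IH] := filter_ex UA.
Qed.

(** Of a set and its complement one lies in [U], and if almost every extension were forced, so would
    be [s]. *)
Lemma not_forced_rcons {FU : UltraFilter U} P s : ~ forced P s ->
  \forall n \near U, ~ forced P (rcons s n).
Proof.
move=> nP; have [UA|//] := in_ultra_setVsetC [set n | forced P (rcons s n)] FU.
by case: nP; exact: forced_later UA _.
Qed.

End Forcing.
Arguments forced U P s : clear implicits.

(** * Sequences that obstruct smallness at a point *)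

Section BadPrefixes.
Local Open Scope classical_set_scope.
Context {R : realType} {V : normedModType R}.
Variables (x : nat -> V) (d : R).

Definition big_on (C : set (V -> R)) (s : seq nat) : Prop :=
  exists2 f, C f & forall i, i \in s -> d <= f (x i).

Definition small_at (C : set (V -> R)) (e : R) (m : nat) : set (V -> R) :=
  [set f | C f /\ `|f (x m)| <= e].

(** Allowing a prefix of [s] to be bad, instead of [s] itself, makes the property stable under
    extension, as [forcedI] requires. *)
Definition has_bad_prefix C e m (s : seq nat) : Prop :=
  exists2 t, prefix t s & big_on C t /\ ~ big_on (small_at C e m) t.

Lemma has_bad_prefix_rcons C e m : rcons_closed (has_bad_prefix C e m).
Proof.
move=> s n [t ts bt]; exists t => //.
by apply: prefix_trans ts _; exact: prefix_rcons.
Qed.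

Lemma big_onS C s t : {subset s <= t} -> big_on C t -> big_on C s.
Proof. by move=> st [f Cf ft]; exists f => // i /st/ft. Qed.

Lemma prefix_leq_subset (s s' t : seq nat) :
  prefix s t -> prefix s' t -> (size s <= size s')%N -> {subset s <= s'}.
Proof.
rewrite !prefixE => /eqP st /eqP s't le i; rewrite -{1}st -(take_takel t le) s't.
exact: mem_take.
Qed.

(* The longest of the bad prefixes is bad for all the points at once. *)
Lemma common_bad_prefix C e (m : nat -> nat) t k :
  (forall j, (j <= k)%N -> has_bad_prefix C e (m j) t) ->
  exists2 s, prefix s t & big_on C s /\
    forall j, (j <= k)%N -> ~ big_on (small_at C e (m j)) s.
Proof.
elim: k => [|k IH] bad.
  have [s st [bs ns]] := bad 0%N isT; exists s => //; split=> // j.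
  by rewrite leqn0 => /eqP ->.
have [|s st [bs ns]] := IH; first by move=> j jk; apply: bad; exact: leqW.
have [s' st' [bs' ns']] := bad k.+1 (leqnn _).
have [/(prefix_leq_subset _ _ _ st st') sub|
  /ltnW/(prefix_leq_subset _ _ _ st' st) sub] := leqP (size s) (size s').
  exists s' => //; split=> // j; rewrite leq_eqVlt => /predU1P[->//|/ns nj b].
  by apply: nj; exact: big_onS b.
exists s => //; split=> // j; rewrite leq_eqVlt => /predU1P[-> b|/ns//].
by apply: ns'; exact: big_onS b.
Qed.

Context {U : set_system nat} {UU : UltraFilter U}.

(* If infinitely many [m] were forced to have a bad prefix, then any finitely many
   of them would share a bad sequence; a limit of the functionals which are big
   on these would stay away from 0 along a subsequence of the weakly null [x]. *)
Lemma eventually_not_forced C e : weakly_null x -> 0 < e ->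
  C `<=` dual_ball ->
  \forall m \near \oo, ~ forced U (has_bad_prefix C e m) [::].
Proof.
move=> wx e0 CB; apply: contrapT => nev.
have ex N : exists m, (N <= m)%N /\ forced U (has_bad_prefix C e m) [::].
  apply: contrapT => nex; apply: nev; exists N => // m /= Nm fm.
  by apply: nex; exists m.
have [m mP] := choice ex.
have exf k : exists f, C f /\ forall j, (j <= k)%N -> e < `|f (x (m j))|.
  have fk : forced U
      [set t | forall j, (j <= k)%N -> has_bad_prefix C e (m j) t] [::].
    elim: k => [|k IH].
      rewrite (_ : mkset _ = has_bad_prefix C e (m 0%N)); first exact: (mP 0%N).2.
      apply/seteqP; split=> t /= => [|b j]; first exact.
      by rewrite leqn0 => /eqP ->.
    rewrite (_ : mkset _ = [set t | forall j, (j <= k)%N ->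
      has_bad_prefix C e (m j) t] `&` has_bad_prefix C e (m k.+1)).
      apply: forcedI IH (mP _).2; last exact: has_bad_prefix_rcons.
      by move=> s n b j jk; exact: has_bad_prefix_rcons (b j jk).
    apply/seteqP; split=> t /= => [b|[b b'] j].
      by split=> [j jk|]; apply: b => //; exact: leqW.
    by rewrite leq_eqVlt => /predU1P[->//|/b].
  have [t /common_bad_prefix[s _ [[f Cf fs] ns]]] := forced_ex _ _ fk.
  exists f; split=> // j /ns nj; rewrite ltNge; apply/negP => small.
  by apply: nj; exists f.
have [f fP] := choice exf.
have fB k : dual_ball (f k) by exact/CB/(fP k).1.
have [W [UW oW]] := ultraFilterLemma (_ : ProperFilter \oo).
have [g gB fg] := dual_ball_ultralimit f W UW fB.
have gm j : e <= `|g (x (m j))|.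
  apply: (cvgr_to_ge (cvg_norm (fg (x (m j))))).
  apply: oW; exists j => // k /= jk; exact/ltW/(fP k).2.
have /cvgrPdist_lt/(_ e e0)[N _ Ng] := dual_ball_cvg0 _ _ wx gB.
have := Ng (m N) (mP N).1.
by rewrite /= sub0r normrN ltNge gm.
Qed.

End BadPrefixes.

(** * Choice of the subsequence and replacement of functionals *)

Lemma dependent_sequence (P : seq nat -> Prop) : P [::] ->
  (forall h, P h -> exists n, P (rcons h n)) ->
  exists m : nat -> nat, forall n, P (mkseq m n).
Proof.
move=> P0 PS.
have /choice[next nextP] : forall h, exists n, P h -> P (rcons h n).
  move=> h; have [/PS[n Pn]|nP] := pselect (P h); first by exists n.
  by exists 0%N.
pose h n := iter n (fun h => rcons h (next h)) [::].
exists (fun n => next (h n)) => n.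
suff -> : mkseq (fun n => next (h n)) n = h n by elim: n => //= n; exact: nextP.
by elim: n => //= n IH; rewrite mkseqS IH.
Qed.

Section Subsequence.
Local Open Scope classical_set_scope.
Context {R : realType} {V : normedModType R}.
Variables (x : nat -> V) (d : R) (eps : nat -> R) (U : set_system nat).

(* The functionals following the pattern [b] on the points [h]: big where [b] is
   true, small where it is false. *)
Definition cell (h : seq nat) (b : seq bool) : set (V -> R) :=
  [set f | dual_ball f /\ forall i, (i < size h)%N ->
    if nth false b i then d <= f (x (nth 0%N h i))
    else `|f (x (nth 0%N h i))| <= eps i].

(** The masked list collects the points after the [k]-th at which [b] asks for a big value.
    Non-forcing is stronger than absence of a bad prefix, and it survives the choice of [U]-almost
    every further point. *)
Definition cell_separated (h : seq nat) : Prop :=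
  forall b : seq bool, size b = size h -> forall k, (k < size h)%N ->
  ~ forced U (has_bad_prefix x d (cell (take k h) b) (eps k) (nth 0%N h k))
      (mask (drop k.+1 b) (drop k.+1 h)).

Lemma cell_rcons h b e : (size h <= size b)%N -> cell h (rcons b e) = cell h b.
Proof.
move=> hb; apply/seteqP; split=> f [fB fh]; split=> // i ih; have := fh i ih;
  by rewrite nth_rcons (leq_trans ih hb).
Qed.

Hypotheses (UU : UltraFilter U) (oU : \oo `<=` U).
Hypotheses (wx : weakly_null x) (eps_gt0 : forall i, 0 < eps i).

(** Finitely many patterns and positions occur, so each may be treated alone. At the new position
    the list of later points is empty and [eventually_not_forced] applies; at an old one the list is
    unchanged or gains [n], and non-forcing persists for almost all [n]. *)
Lemma separated_rcons h :
  cell_separated h -> \forall n \near U, cell_separated (rcons h n).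
Proof.
move=> sh.
have: \forall n \near U, forall (b : (size h).-tuple bool) (e : bool)
    (k : 'I_(size h).+1),
  ~ forced U (has_bad_prefix x d (cell (take k (rcons h n)) (rcons b e)) (eps k)
      (nth 0%N (rcons h n) k))
    (mask (drop k.+1 (rcons b e)) (drop k.+1 (rcons h n))).
  apply: filter_forall => b; apply: filter_forall => e; apply: filter_forall => k.
  have: size b = size h by rewrite size_tuple.
  move: {b}(tval b) => b szb.
  have := ltn_ord k; rewrite ltnS leq_eqVlt => /predU1P[kE|kh].
    have ev := eventually_not_forced x d (cell h b) (eps (size h)) wx (eps_gt0 _)
      (fun f => @proj1 _ _).
    move: (oU _ (ev U UU)); apply: filterS => n.
    rewrite kE !drop_oversize ?size_rcons ?szb//= nth_rcons ltnn eqxx.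
    by rewrite -cats1 take_size_cat// cell_rcons ?szb.
  have nf := sh b szb k kh.
  suff: \forall n \near U,
    ~ forced U (has_bad_prefix x d (cell (take k h) b) (eps k) (nth 0%N h k))
        (mask (drop k.+1 b) (drop k.+1 h) ++ nseq e n).
    apply: filterS => n.
    rewrite !drop_rcons ?szb// mask_rcons ?size_drop ?szb// nth_rcons kh.
    rewrite -[rcons h n]cats1 takel_cat ?(ltnW kh)// cell_rcons//.
    by rewrite size_takel ?szb ltnW.
  case: e => /=; last by apply: nearW => n; rewrite cats0.
  by have := not_forced_rcons _ _ nf => /(_ UU); apply: filterS => n; rewrite cats1.
apply: filterS => n sn b; rewrite size_rcons => szb k kh.
case/lastP: b szb => [//|b e]; rewrite size_rcons => -[szb].
exact: (sn (Tuple (introT eqP szb)) e (Ordinal kh)).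
Qed.

Lemma separated_subsequence : exists m : nat -> nat,
  [/\ forall i, (m i < m i.+1)%N, forall i, (0 < m i)%N &
      forall n, cell_separated (mkseq m n)].
Proof.
(* The leading [0] forces the chosen points to be positive. *)
have [||m mP] := @dependent_sequence
  (fun h => sorted ltn (0%N :: h) /\ cell_separated h).
- by split=> // b _ [].
- move=> h [sh /separated_rcons sep].
  have big : \forall n \near U, (last 0%N h < n)%N.
    by apply: oU; exists (last 0%N h).+1.
  have [n [ln sn]] := filter_ex (filterI big sep).
  by exists n; split=> //=; rewrite rcons_path -/(sorted ltn (0%N :: h)) sh.
exists m; split=> [i|i|n]; last exact: (mP n).2.
  have := (mP i.+2).1; rewrite !mkseqS /= !rcons_path.
  by rewrite last_rcons => /andP[].
have := (mP i.+1).1; rewrite !mkseqS /= rcons_path => /andP[_].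
exact: leq_ltn_trans.
Qed.

(** The points are treated in increasing order. At a point to be made small, separation supplies a
    new functional that keeps the pattern at the earlier points and stays big at the later big
    ones. *)
Lemma separated_functional (m : nat -> nat) N (b : nat -> bool) f :
  cell_separated (mkseq m N) -> dual_ball f ->
  (forall i, (i < N)%N -> b i -> d <= f (x (m i))) ->
  exists2 g, dual_ball g & forall i, (i < N)%N ->
    if b i then d <= g (x (m i)) else `|g (x (m i))| <= eps i.
Proof.
move=> sep fB fb.
have H k : (k <= N)%N -> exists2 g, cell (mkseq m k) (mkseq b N) g &
    forall i, (i < N)%N -> b i -> d <= g (x (m i)).
  elim: k => [|k IH] kN; first by exists f.
  have [g [gB gk] gb] := IH (ltnW kN).
  have cellS g' : cell (mkseq m k) (mkseq b N) g' ->
      (if b k then d <= g' (x (m k)) else `|g' (x (m k))| <= eps k) ->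
      cell (mkseq m k.+1) (mkseq b N) g'.
    move=> [g'B]; rewrite size_mkseq => g'k g'kk; split=> // i; rewrite size_mkseq.
    rewrite ltnS leq_eqVlt => /predU1P[->|ik]; first by rewrite !nth_mkseq.
    by have := g'k i ik; rewrite !nth_mkseq// ?(ltn_trans ik)//.
  case bk : (b k).
    by exists g => //; apply: cellS => //; rewrite bk gb.
  have := sep (mkseq b N); rewrite !size_mkseq => /(_ erefl k kN).
  rewrite {1}/mkseq -map_take take_iota (minn_idPl (ltnW kN)) -/(mkseq m k).
  rewrite nth_mkseq//.
  set s := mask _ _ => nf.
  have sP i : i \in s <-> exists j, [/\ (k < j)%N, (j < N)%N, b j & i = m j].
    rewrite /s /mkseq -!map_drop -map_mask -filter_mask drop_iota add0n.
    split=> [/mapP[j]|[j [kj jN bj ->]]].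
      rewrite mem_filter mem_iota subnKC// => /and3P[bj kj jN] ->.
      by exists j.
    by apply: map_f; rewrite mem_filter mem_iota subnKC// bj kj.
  have [g' [g'c g'k] g's] :
      big_on x d (small_at x (cell (mkseq m k) (mkseq b N)) (eps k) (m k)) s.
    (* Otherwise [s] is a bad prefix of itself, as [g] is big on it, and is therefore forced at
       once. *)
    apply: contrapT => ns; apply: nf; apply: forced_now.
    exists s; first exact: prefix_refl.
    split=> //; exists g => // i /sP[j [_ jN bj ->]]; exact: gb.
  exists g'; first by apply: cellS => //; rewrite bk.
  move=> i iN bi; have [ik|ki|ik] := ltngtP i k; last by rewrite ik bk in bi.
    have := g'c.2 i; rewrite !size_mkseq ik => /(_ isT).
    by rewrite !nth_mkseq// bi.
  by apply: g's; apply/sP; exists i.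
have [g [gB gN] _] := H N (leqnn N); exists g => // i iN.
by have := gN i; rewrite size_mkseq iN => /(_ isT); rewrite !nth_mkseq.
Qed.

End Subsequence.

(** * Schreier sets *)

Lemma schreier_sorted xi F : schreier xi F -> sorted ltn F.
Proof.
elim: xi F => [|z _|f IH] F /=.
- by case=> [->|[n [_ ->]]].
- by case=> [->//|[Fs [-> ]]].
- by case=> [->//|[n [_ /IH]]].
Qed.

Lemma schreier_gt0 xi F i : schreier xi F -> i \in F -> (0 < i)%N.
Proof.
elim: xi F => [|z IH|f IH] F /=.
- by case=> [->//|[n [n0 ->]]]; rewrite mem_seq1 => /eqP ->.
- by case=> [->//|[Fs [-> _ _ FsP _]]] /flattenP[G /FsP /IH]; exact.
- by case=> [->//|[n [_ /IH]]]; exact.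
Qed.

(** Moving points to the right preserves their order and the number of blocks and can only raise
    minima, so admissibility persists at each level. *)
Lemma schreier_map xi (m : nat -> nat) F :
  {homo m : i j / (i < j)%N} -> (forall i, (i <= m i)%N) ->
  schreier xi F -> schreier xi (map m F).
Proof.
move=> mS mge; elim: xi F => [|z IH|f IH] F /=.
- case=> [->|[n [n0 ->]]]; [by left|right]; exists (m n); split=> //.
  exact: leq_trans n0 (mge n).
- case=> [->|[Fs [-> sF [Fs0 Fsn] FsP szF]]]; [by left|right].
  exists (map (map m) Fs); split.
  + by rewrite map_flatten.
  + by rewrite -map_flatten; exact: homo_sorted sF.
  + split; first by case: Fs Fs0 {sF Fsn FsP szF}.
    by rewrite all_map; apply: sub_all Fsn => -[].
  + by move=> _ /mapP[G /FsP/IH mG ->].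
  + rewrite size_map; apply: (leq_trans szF).
    by case: Fs Fs0 Fsn {sF FsP szF} => [//|[//|i G] Fs] _ _; exact: mge.
- case=> [->|[n [nF /IH mF]]]; [by left|right]; exists n; split=> //.
  by case: F nF {mF} => [//|i F] /= nF; exact: leq_trans nF (mge i).
Qed.

(** * Finite sums and norm estimates *)

Lemma sum_mem {V : nmodType} (s t : seq nat) (A : nat -> V) :
  uniq s -> uniq t -> {subset s <= t} ->
  \sum_(j <- t) (if j \in s then A j else 0) = \sum_(j <- s) A j.
Proof.
move=> us ut st; rewrite -big_mkcond -big_filter; apply: perm_big.
apply: uniq_perm => //; first exact: filter_uniq.
by move=> j; rewrite mem_filter andb_idr//; exact: st.
Qed.

Section Estimates.
Context {R : realType} {V : normedModType R}.
Implicit Types (x : nat -> V) (a : nat -> R).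

(** The vector [a i *: x i] is a tail of an initial segment of the sum, so bimonotonicity is used
    twice. *)
Lemma bimonotone_coef_le x a N i : bimonotone x -> normalized x ->
  (forall j, (N <= j)%N -> a j = 0) -> (0 < i)%N ->
  `|a i| <= `|\sum_(1 <= j < N) a j *: x j|.
Proof.
move=> bx nx a0 i0; apply: le_trans (bx a N a0 i).1.
pose a' j := if (j <= i)%N then a j else 0.
have a'0 j : (i.+1 <= j)%N -> a' j = 0 by rewrite /a' ltnNge => /negPf ->.
have := (bx a' i.+1 a'0 i.-1).2; rewrite prednK// big_nat1 {1}/a' leqnn.
rewrite normrZ nx// mulr1 => /le_trans; apply.
rewrite le_eqVlt; apply/predU1P; left; congr (`| _ |).
by apply: eq_big_nat => j /andP[_]; rewrite ltnS /a' => ->.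
Qed.

(** Transporting the coefficients to the range of [m], with 0 elsewhere, turns the sum into one
    along [x]. *)
Lemma bimonotone_subseq_coef_le x (m : nat -> nat) a N i :
  bimonotone x -> normalized x ->
  {homo m : i j / (i < j)%N} -> (forall i, (0 < m i)%N) ->
  (0 < i < N)%N ->
  `|a i| <= `|\sum_(1 <= j < N) a j *: x (m j)|.
Proof.
move=> bx nx mS m0 /andP[i0 iN].
have mI : injective m by apply: incn_inj; exact: leq_mono.
pose b k := \sum_(1 <= j < N) (if m j == k then a j else 0).
have bi : b (m i) = a i.
  rewrite /b (bigD1_seq i)/= ?mem_index_iota ?i0 ?iN ?iota_uniq// eqxx.
  by rewrite big1 ?addr0// => j /negPf ji; rewrite (inj_eq mI) ji.
have b0 k : (m N <= k)%N -> b k = 0.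
  move=> Nk; rewrite /b big_nat big1// => j /andP[_ jN].
  by case: eqP => // mk; have := mS _ _ jN; rewrite mk ltnNge Nk.
rewrite -bi; apply: le_trans (bimonotone_coef_le _ _ _ (m i) bx nx b0 (m0 i)) _.
rewrite le_eqVlt; apply/predU1P; left; congr (`| _ |).
under eq_bigr do rewrite /b scaler_suml.
rewrite exchange_big /=; apply: eq_big_nat => j /andP[j0 jN].
rewrite (bigD1_seq (m j))/= ?mem_index_iota ?m0 ?mS ?iota_uniq// eqxx.
by rewrite big1 ?addr0// => k /negPf kj; rewrite eq_sym kj scale0r.
Qed.

Lemma sum_half_pow_le1 N : \sum_(1 <= i < N) (2^-1 : R) ^+ i.+1 <= 1.
Proof.
suff H n : \sum_(0 <= i < n) (2^-1 : R) ^+ i.+1 = 1 - 2^-1 ^+ n.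
  apply: (@le_trans _ _ (\sum_(0 <= i < N) (2^-1 : R) ^+ i.+1)).
    case: N => [|N]; first by rewrite !big_geq.
    by rewrite [leRHS]big_ltn// lerDr exprn_ge0// invr_ge0.
  by rewrite H lerBlDr lerDl exprn_ge0// invr_ge0.
elim: n => [|n IH]; first by rewrite big_geq// expr0 subrr.
by rewrite big_nat_recr//= IH exprS; lra.
Qed.

Lemma positive_part_le x (m : nat -> nat) (c : R) F a N :
  let y := fun i => x (m i) in
  let S := `|\sum_(1 <= i < N) a i *: y i| in
  (forall i, (0 < i < N)%N -> `|a i| <= S) ->
  (forall i, (N <= i)%N -> a i = 0) ->
  uniq F -> (forall i, i \in F -> (0 < i)%N) ->
  (forall (b : nat -> bool) f, dual_ball f ->
    (forall i, (i < N)%N -> b i -> c <= f (y i)) ->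
    exists2 g, dual_ball g & forall i, (i < N)%N ->
      if b i then c <= g (y i) else `|g (y i)| <= 2^-1 ^+ i.+1) ->
  (exists2 f, dual_ball f & forall i, i \in F -> 0 < a i -> c <= f (y i)) ->
  c * \sum_(i <- F | 0 < a i) a i <= 2 * S.
Proof.
move=> y S aS a0 uF F0 sep [f fB fF].
pose b i := (i \in F) && (0 < a i).
have [|g [gl gB] gb] := sep b f fB; first by move=> i _ /andP[]; exact: fF.
have gS : \sum_(1 <= i < N) a i * g (y i) <= S.
  rewrite -linear_form_sum//; exact: le_trans (ler_norm _) (gB _).
have S0 : 0 <= S by exact: normr_ge0.
have -> : c * \sum_(i <- F | 0 < a i) a i =
    \sum_(1 <= i < N) (if b i then c * a i else 0).
  rewrite mulr_sumr -big_filter -[LHS](sum_mem _ (index_iota 1 N)).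
  - by apply: eq_bigr => i _; rewrite mem_filter andbC.
  - exact: filter_uniq.
  - exact: iota_uniq.
  - move=> i; rewrite mem_filter mem_index_iota => /andP[ai iF].
    rewrite F0//= ltnNge; apply/negP => /a0 ai0; by rewrite ai0 ltxx in ai.
(* Outside [b] each term loses at most [2^-1 ^+ i.+1 * S], in total at most [S]; the other [S] in
   the bound comes from [gS]. *)
suff : \sum_(1 <= i < N) (if b i then c * a i else 0) <=
    \sum_(1 <= i < N) (a i * g (y i) + 2^-1 ^+ i.+1 * S).
  rewrite big_split /= -mulr_suml => le1.
  have := ler_wpM2r S0 (sum_half_pow_le1 N); lra.
rewrite big_nat [leRHS]big_nat; apply: ler_sum => i /andP[i0 iN].
have := gb i iN; case: ifP => [/andP[_ ai] cg|_ gi].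
  have : a i * c <= a i * g (y i) by rewrite ler_wpM2l// ltW.
  have : 0 <= (2^-1 : R) ^+ i.+1 * S by rewrite mulr_ge0// exprn_ge0// invr_ge0.
  lra.
have : - (a i * g (y i)) <= 2^-1 ^+ i.+1 * S.
  apply: le_trans (ler_norm _) _; rewrite normrN normrM mulrC.
  by apply: ler_pM => //; apply: aS; rewrite i0.
lra.
Qed.

Lemma sum_norm_posneg a (F : seq nat) :
  \sum_(i <- F) `|a i| =
  \sum_(i <- F | 0 < a i) a i + \sum_(i <- F | 0 < - a i) - a i.
Proof.
rewrite [X in _ = X + _]big_mkcond [X in _ = _ + X]big_mkcond -big_split.
apply: eq_bigr => i _ /=; rewrite oppr_gt0.
case: ltgtP => [ai|ai|<-]; last by rewrite normr0 addr0.
  by rewrite addr0 gtr0_norm.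
by rewrite add0r ltr0_norm.
Qed.

End Estimates.

(** * Unconditionality on Schreier sets *)

Theorem theorem1p10 (R : realType) (V : completeNormedModType R)
  (x : nat -> V) (xi : cord) :
  ctbl_ordinal xi ->
  normalized x -> bimonotone x -> weakly_null x ->
  ell1_spreading_model xi x ->
  exists m : nat -> nat, (forall i, (m i < m i.+1)%N) /\
    schreier_unconditional xi (fun i => x (m i)).
Proof.
move=> _ nx bx wx [_ [c c0 xl1]].
have [U [UU oU]] := ultraFilterLemma (_ : ProperFilter \oo%classic).
have eps0 (i : nat) : 0 < (2^-1 : R) ^+ i.+1 by rewrite exprn_gt0// invr_gt0.
have [m [mS m0 msep]] := separated_subsequence x c _ U UU oU wx eps0.
exists m; split=> //; have {}mS : {homo m : i j / (i < j)%N}.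
  exact: homo_ltn ltn_trans mS.
have mge i : (i <= m i)%N.
  by elim: i => // i; move/leq_ltn_trans; apply; exact: mS.
(* The positive and the negative coefficients contribute [2 * S / c] each. *)
exists (4 / c); first by rewrite divr_gt0.
move=> F FS a N a0; set S := `|\sum_(1 <= i < N) _|.
have uF : uniq F by exact: sorted_uniq ltn_trans ltnn _ (schreier_sorted _ _ FS).
have F0 i : i \in F -> (0 < i)%N by exact: (schreier_gt0 _ _ _ FS).
have mI : injective m by apply: incn_inj; exact: leq_mono.
have umF : uniq (map m F) by rewrite map_inj_uniq.
have norming (P : pred nat) : exists2 f, dual_ball f &
    forall i, i \in F -> P i -> c <= f (x (m i)).
  have [||f fB fF] := norming_functional x (map m [seq i <- F | P i]) c.
  - by rewrite map_inj_uniq// filter_uniq.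
  - move=> b b0; set s := map m _.
    have us : uniq s by rewrite map_inj_uniq// filter_uniq.
    have sF : {subset s <= map m F} by apply/mem_subseq/map_subseq/filter_subseq.
    (* The coefficients on the selected part are extended by 0 to all of [map m F], to which the
       lower estimate applies. *)
    have := xl1 _ (schreier_map _ _ _ mS mge FS)
      (fun j => if j \in s then b j else 0).
    rewrite (eq_bigr (fun j => if j \in s then b j else 0)); last first.
      by move=> j _; case: ifP => _; rewrite ?normr0// ger0_norm.
    rewrite [X in _ <= `|X|](eq_bigr
      (fun j => if j \in s then b j *: x j else 0)); last first.
      by move=> j _; case: ifP => _; rewrite ?scale0r.
    by rewrite !sum_mem.
  - by exists f => // i iF Pi; apply: fF; apply: map_f; rewrite mem_filter Pi.
have coef i : (0 < i < N)%N -> `|a i| <= S.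
  exact: bimonotone_subseq_coef_le.
have sep (b : nat -> bool) f := separated_functional x c _ U m N b f (msep N).
have pos : c * \sum_(i <- F | 0 < a i) a i <= 2 * S.
  exact: positive_part_le.
have neg : c * \sum_(i <- F | 0 < - a i) - a i <= 2 * S.
  have SN : `|\sum_(1 <= i < N) (- a i) *: x (m i)| = S.
    rewrite -normrN -sumrN; congr `|_|; apply: eq_bigr => i _.
    by rewrite scaleNr opprK.
  rewrite -SN; apply: (positive_part_le _ _ _ F (fun i => - a i)) => // [i|i /a0 ->].
    by rewrite SN normrN; exact: coef.
  by rewrite oppr0.
have : `|\sum_(i <- F) a i *: x (m i)| <= \sum_(i <- F) `|a i|.
  apply: le_trans (ler_norm_sum _ _ _) _.
  by apply: ler_sum => i _; rewrite normrZ nx ?mulr1.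
move=> /le_trans; apply.
rewrite mulrAC ler_pdivlMr// mulrC sum_norm_posneg mulrDr.
by apply: le_trans (lerD pos neg) _; lra.
Qed.
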